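(* Let $s$ be an even positive integer and let $n$ be an odd integer with $n>3s$. Set $f(X)=X^n+X^{n-s}+X^{n-2s}+X^{n-3s}+1\in\mathbb{F}_2[X]$ and let $t_f$ be the number of irreducible factors of $f$ in $\mathbb{F}_2[X]$. Then $$t_f\equiv\begin{cases}1\pmod 2, & \text{if } n\equiv\pm1\pmod 8,\\ 0\pmod 2, & \text{otherwise}.\end{cases}$$
   Context: $\mathbb{F}_2$ denotes the field with two elements. The number of irreducible factors of a polynomial is the number of factors in its factorization into irreducible polynomials over $\mathbb{F}_2$, counted with multiplicity. *)

(* Defs.v *)
From HB Require Import structures.
From mathcomp Require Import all_boot all_order all_algebra all_field.

Set Implicit Arguments.
Unset Strict Implicit.
Unset Printing Implicit Defensive.

Import GRing.Theory.
Local Open Scope ring_scope.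

(* [s] lists, with repetitions, the factors of a factorization of [p] into
   irreducible polynomials, the leading coefficient of [p] being absorbed
   by [%=]. *)
Definition irr_factorization (F : finFieldType) (p : {poly F})
    (s : seq {poly F}) : bool :=
  all (@irreducibleb F) s && (p %= \prod_(q <- s) q).

Lemma irr_factorizationP (F : finFieldType) (p : {poly F}) (s : seq {poly F}) :
  reflect ((forall q, q \in s -> irreducible_poly q) /\
           p %= \prod_(q <- s) q)
          (irr_factorization p s).
Proof.
apply: (iffP andP) => -[irr_s p_s]; split=> //.
  by move=> q /(allP irr_s)/irreducibleP.
by apply/allP => q /irr_s/irreducibleP.
Qed.

Lemma irr_factorization_exists (F : finFieldType) (p : {poly F}) :
  exists s, (p != 0) ==> irr_factorization p s.
Proof.
have [n] := ubnP (size p); elim: n p => // n IHn p le_p_n.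
have [-> | p0] := eqVneq p 0; first by exists [::].
have [p1 | p1] := eqVneq (size p) 1.
  by exists [::]; rewrite /irr_factorization big_nil -size_poly_eq1 p1.
have [irr_p | red_p] := boolP (irreducibleb p).
  by exists [:: p]; rewrite /irr_factorization /= irr_p big_seq1 eqpxx.
have p_gt1 : (1 < size p)%N by rewrite ltn_neqAle eq_sym p1 size_poly_gt0.
have [q q1 [q_p q_neq]] :
    exists2 q : {poly F}, size q != 1 & q %| p /\ ~~ (q %= p).
  move: red_p; rewrite /irreducibleb p_gt1 /= => /forallPn[q].
  rewrite negb_imply -ltnNge => /andP[q_p q_gt1].
  exists (val q); last split.
  - by rewrite neq_ltn q_gt1 orbT.
  - by rewrite Pdiv.Idomain.dvdpE.
  - apply: contraL (size_npoly q) => /eqp_size ->.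
    by rewrite -ltnNge prednK // ltnW.
have def_p := divpK q_p.
have rq0 : (p %/ q != 0) && (q != 0).
  by move: p0; rewrite -{1}def_p mulf_eq0 negb_or.
have [r0 q0] := andP rq0.
have szp : size p = (size (p %/ q) + size q).-1.
  by rewrite -{1}def_p size_mul.
have lt_q : (size q < size p)%N.
  rewrite ltn_neqAle dvdp_leq // andbT.
  by apply: contra q_neq => /eqP szq; rewrite -dvdp_size_eqp // szq.
have lt_r : (size (p %/ q)%R < size p)%N.
  rewrite szp; move: q1 q0; rewrite -size_poly_gt0.
  by case: (size q) => [|[|m]] // _ _; rewrite !addnS /= ltnS leq_addr.
have [s] := IHn _ (leq_trans lt_r le_p_n).
have [t] := IHn _ (leq_trans lt_q le_p_n).
rewrite q0 r0 /= => /andP[irr_t q_t] /andP[irr_s r_s].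
exists (s ++ t); rewrite /irr_factorization all_cat irr_s irr_t big_cat /=.
by rewrite -def_p (eqp_trans (eqp_mulr _ r_s)) ?eqp_mull.
Qed.

(* Junk value for [p = 0], which has no such factorization. *)
Definition irr_factors (F : finFieldType) (p : {poly F}) : seq {poly F} :=
  xchoose (irr_factorization_exists p).

Definition num_irr_factors (F : finFieldType) (p : {poly F}) : nat :=
  size (irr_factors p).

Lemma irr_factorsP (F : finFieldType) (p : {poly F}) :
  p != 0 -> irr_factorization p (irr_factors p).
Proof. exact/implyP/(xchooseP (irr_factorization_exists p)). Qed.

Lemma irr_dvdp_prod (F : finFieldType) (p : {poly F}) (s : seq {poly F}) :
  irreducible_poly p -> p %| \prod_(q <- s) q -> exists2 q, q \in s & p %| q.
Proof.
move=> irr_p; elim: s => [|q s IHs].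
  by rewrite big_nil dvdp1; case: irr_p => + _ => /gtn_eqF ->.
rewrite big_cons; have [p_q _ | p_q] := boolP (p %| q).
  by exists q; rewrite ?mem_head.
rewrite Gauss_dvdpr ?irreducible_poly_coprime // => /IHs[r rs p_r].
by exists r; rewrite // in_cons rs orbT.
Qed.

(* The choice made in [irr_factors] is immaterial. *)
Lemma num_irr_factorsE (F : finFieldType) (p : {poly F}) (s : seq {poly F}) :
  p != 0 -> irr_factorization p s -> num_irr_factors p = size s.
Proof.
move=> p0 /irr_factorizationP[irr_s p_s].
have /irr_factorizationP[irr_t p_t] := irr_factorsP p0.
rewrite /num_irr_factors; move: (irr_factors p) irr_t p_t => t irr_t p_t.
have: \prod_(q <- t) q %= \prod_(q <- s) q by rewrite -(eqp_ltrans p_t).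
elim: t s irr_t irr_s {p p0 p_s p_t} => [|q t IHt] s irr_t irr_s.
  case: s irr_s => // q s irr_s; rewrite big_nil => E.
  have [q_gt1 _] := irr_s q (mem_head _ _).
  have: q %| 1 by rewrite (eqp_dvdr _ E) big_cons dvdp_mulIl.
  by rewrite dvdp1 gtn_eqF.
rewrite big_cons => E; have irr_q := irr_t q (mem_head _ _).
have [|r rs q_r] := @irr_dvdp_prod F q s irr_q.
  by rewrite -(eqp_dvdr _ E) dvdp_mulIl.
have q_eq_r : q %= r.
  by case: (irr_s r rs) => _; apply => //; case: irr_q => /gtn_eqF ->.
rewrite (perm_size (perm_to_rem rs)) /=; congr _.+1; apply: IHt.
- by move=> u ut; apply: irr_t; rewrite in_cons ut orbT.
- by move=> u /mem_rem/irr_s.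
rewrite -(eqp_mul2l _ _ (irredp_neq0 irr_q)) (eqp_trans E) //.
by rewrite (perm_big _ (perm_to_rem rs)) big_cons eqp_mulr // eqp_sym.
Qed.

(* Main.v *)
Require Import Defs.
From mathcomp Require Import all_boot all_order all_fingroup all_algebra all_field.
From mathcomp Require Import ring zify.
From mathcomp Require Import mpoly.

(** The parity of the number of irreducible factors is read off a discriminant,
following Stickelberger and Swan.

Let [f] be squarefree of degree [n] over 'F_2. The Frobenius map permutes the
[n] roots of [f] in a splitting field, and the cycles of this permutation [s] are
the root sets of the irreducible factors ([num_irr_factors_porbits]); so the
number of factors has the parity of [n] if and only if [s] is even. To compute
the sign of [s], put B = sum_(i < j) y_i / (y_i + y_j) over the roots y_i.
Frobenius squares B, but also permutes its terms, and each inverted pair turns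
y_i / (y_i + y_j) into y_j / (y_i + y_j) = 1 + y_i / (y_i + y_j). Hence
B ^ 2 + B, which equals sum_(i < j) y_i y_j / (y_i + y_j) ^ 2, is the parity of
[s] ([Frobenius_parity]).

To transport this sum to characteristic 0, let [F] be a monic lift of [f] to Z
with complex roots x_i. The product over i < j of (x_i + x_j) ^ 2 + x_i x_j Z is a
symmetric function of the roots with coefficients in Z[Z]: by the fundamental
theorem on symmetric polynomials it is a polynomial g with integer coefficients,
and reducing g modulo 2 gives the same expression in the y_i ([disc_pencil]).
At Z = -4 the factors become (x_i - x_j) ^ 2, so disc F = g(-4) is congruent to
g_0 - 4 g_1 modulo 16. Here g_0 is an odd square, and g_1 modulo 2 is the sum
above. This gives disc F = 1 + 4 (n + t) modulo 8, where t is the number of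
irreducible factors of [f] ([Stickelberger_Swan]).

There remains to compute the discriminant modulo 8 for
F = X^n + X^(n-s) + X^(n-2s) + X^(n-3s) + 1. Up to the sign (-1) ^ 'C(n, 2), it
is the product of the F'(x_i). The product of the roots is -1, and
x F'(x) = - (n + s h(x)) at a root x, where h = X^(n-s) + 2 X^(n-2s) + 3 X^(n-3s).
Since [s] is even, modulo 8 the product of the n + s h(x_i) depends only on the sum
of the h(x_i) and on the sum of their squares modulo 4. Newton's identities show that the sums of odd powers of degree
less than [n] vanish, so the first sum is 0 and the second is divisible by 4:
the product is [n] modulo 8 ([pentanomial_disc_mod8]). Comparing the two values
of the discriminant gives the statement. *)

Set Implicit Arguments.
Unset Strict Implicit.

Import Order.TTheory GRing.Theory Num.Theory.
Local Open Scope ring_scope.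

(** * Symmetric functions of the roots of a polynomial *)

Lemma mmap_comp_mpoly (K R : comNzRingType) (phi : {rmorphism K -> R}) (m n : nat)
    (h : 'I_n -> R) (t : {mpoly K[m]}) (u : m.-tuple {mpoly K[n]}) :
  mmap phi h (t \mPo u) = mmap phi (fun i => mmap phi h (tnth u i)) t.
Proof.
rewrite comp_mpolyEX raddf_sum; apply: eq_bigr => a _ /=.
rewrite mmapZ comp_mpolyX rmorph_prod; congr (_ * _); apply: eq_bigr => i _.
by rewrite rmorphXn.
Qed.

(** The point is that the value [m] is found over the ring of coefficients, before
the ring containing the roots is chosen: it links the roots of an integer
polynomial in characteristic 0 with those of its reduction modulo 2. *)
Lemma symmetric_eval (K : comNzRingType) (n : nat) (p : {mpoly K[n]}) (F : {poly K}) :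
  p \is symmetric ->
  exists m : K, forall (R : idomainType) (phi : {rmorphism K -> R}) (x : 'I_n -> R),
    map_poly phi F = \prod_i ('X - (x i)%:P) -> mmap phi x p = phi m.
Proof.
move=> /sym_fundamental [t [<- _]].
exists t.@[fun i : 'I_n => (-1) ^+ i.+1 * F`_(n - i.+1)] => R phi x Fx.
rewrite mmap_comp_mpoly mevalE rmorph_sum; apply: eq_bigr => a _.
rewrite rmorphM; congr (_ * _); rewrite rmorph_prod; apply: eq_bigr => i _.
rewrite rmorphXn; congr (_ ^+ _); rewrite rmorphM rmorphXn rmorphN1 -coef_map Fx.
have ltin : (i.+1 < n.+1)%N by rewrite ltnS.
pose xt := [tuple x j | j < n].
have -> : \prod_j ('X - (x j)%:P) = \prod_(c <- xt) ('X - c%:P).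
  by rewrite big_tuple; apply: eq_bigr => j _; rewrite tnth_mktuple.
rewrite (mroots_coeff xt (Ordinal ltin)) mulrA -expr2 sqrr_sign mul1r.
rewrite tnth_mktuple /mesym /meval !raddf_sum; apply: eq_bigr => A _.
rewrite /= !rmorph_prod; apply: eq_bigr => j _.
by rewrite /= !mmapX !mmap1U tnth_mktuple.
Qed.

(** * Unordered pairs of indices and the parity of a permutation *)

(** Unordered pairs are listed as the pairs [i < j]; [s] acts on them, up to a
swap of the two entries, which a symmetric [Phi] does not see. *)
Lemma big_ltn_pair_perm (T : Type) (idx : T) (op : Monoid.com_law idx) (n : nat)
    (Phi : 'I_n -> 'I_n -> T) (s : 'S_n) :
  (forall i j, Phi i j = Phi j i) ->
  \big[op/idx]_(p : 'I_n * 'I_n | (p.1 < p.2)%N) Phi (s p.1) (s p.2)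
    = \big[op/idx]_(p : 'I_n * 'I_n | (p.1 < p.2)%N) Phi p.1 p.2.
Proof.
move=> PhiC.
pose h (t : 'S_n) (p : 'I_n * 'I_n) :=
  if (t p.1 < t p.2)%N then (t p.1, t p.2) else (t p.2, t p.1).
have hP t (p : 'I_n * 'I_n) : (p.1 < p.2)%N -> ((h t p).1 < (h t p).2)%N.
  move=> lt12; rewrite /h; case: (ltnP (t p.1)) => //= le21; rewrite ltn_neqAle le21 andbT.
  by apply: contraTneq lt12 => /val_inj/perm_inj->; rewrite ltnn.
have hK t (p : 'I_n * 'I_n) : (p.1 < p.2)%N -> h (t^-1)%g (h t p) = p.
  case: p => i j /= lt12; rewrite /h /=.
  by case: (ltnP (t i)) => _ /=; rewrite !permK ?lt12 // ltnNge ltnW.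
rewrite [RHS](reindex_onto (h s) (h (s^-1)%g)) /=; last first.
  by move=> p /(hK s^-1%g); rewrite invgK.
apply: eq_big => [p | p lt12]; last by rewrite /h; case: ifP => _ //=.
apply/idP/andP => [lt12 | [lt12 /eqP <-]]; last exact: hP.
by rewrite hP // hK.
Qed.

(** The two Vandermonde determinants of 0, ..., n - 1 and of its permutation by
[s] differ by the sign of [s]. As products of differences they have the same
absolute value, and differ by one sign for each inversion. *)
Lemma odd_inversions (n : nat) (s : 'S_n) :
  odd (\sum_(p : 'I_n * 'I_n | (p.1 < p.2)%N) (s p.2 < s p.1)) = s :> bool.
Proof.
pose a : 'rV[int]_n := \row_j j%:Z.
have Vandermonde_pairs (b : 'rV[int]_n) : \det (Vandermonde n b)
  = \prod_(p : 'I_n * 'I_n | (p.1 < p.2)%N) (b 0 p.2 - b 0 p.1).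
  by rewrite det_Vandermonde pair_big_dep.
have: \det (Vandermonde n (col_perm s a)) = (-1) ^+ s * \det (Vandermonde n a).
  have ->: Vandermonde n (col_perm s a) = col_perm s (Vandermonde n a).
    by apply/matrixP=> i j; rewrite !mxE.
  by rewrite col_permE det_mulmx det_perm odd_permV mulrC.
rewrite !Vandermonde_pairs.
rewrite (eq_bigr (fun p : 'I_n * 'I_n =>
  (-1) ^+ (s p.2 < s p.1)%N * `|(s p.2)%:Z - (s p.1)%:Z|)); last first.
  move=> p _; rewrite !mxE; case: ltnP => [lt | le].
    by rewrite expr1 mulN1r ltr0_norm ?opprK // subr_lt0.
  by rewrite mul1r ger0_norm // subr_ge0.
rewrite big_split /= -expr_sum.
rewrite (@big_ltn_pair_perm _ _ _ n (fun i j => `|j%:Z - i%:Z|)); last first.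
  by move=> i j; rewrite distrC.
rewrite [X in _ = _ * X](eq_bigr (fun p : 'I_n * 'I_n => `|p.2%:Z - p.1%:Z|)); last first.
  by move=> p lt12; rewrite !mxE ger0_norm // subr_ge0 lez_nat ltnW.
move/mulIf => H.
have {H} : (-1) ^+ (\sum_(p : 'I_n * 'I_n | (p.1 < p.2)%N) (s p.2 < s p.1)) = (-1) ^+ s :> int.
  apply: H; apply/prodf_neq0 => p lt12.
  by rewrite normr_eq0 subr_eq0 eqz_nat neq_ltn lt12 orbT.
rewrite -signr_odd; by case: odd; case: (s : bool).
Qed.

Lemma card_ltn_pairs (n : nat) : #|[pred p : 'I_n * 'I_n | (p.1 < p.2)%N]| = 'C(n, 2).
Proof.
rewrite -bin2_sum -sum1_card big_mkord.
rewrite -(pair_big_dep xpredT (fun i j : 'I_n => (i < j)%N) (fun _ _ => 1%N)) /=.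
rewrite (exchange_big_dep xpredT) //=; apply: eq_bigr => j _.
rewrite -(big_ord_widen n (fun=> 1%N)) ?(ltnW (ltn_ord j)) //.
by rewrite sum_nat_const card_ord muln1.
Qed.

(** * The sign of the Frobenius permutation of the roots *)

(** The sum is B ^ 2 + B for B = sum_(i < j) x i / (x i + x j), and squaring B
permutes its summands by [s], up to adding 1 for each inversion of [s]. *)
Lemma Frobenius_parity (L : fieldType) (n : nat) (x : 'I_n -> L) (s : 'S_n) :
    2%N \in [pchar L] -> injective x -> (forall i, x i ^+ 2 = x (s i)) ->
  \sum_(p : 'I_n * 'I_n | (p.1 < p.2)%N) (x p.1 * x p.2) / (x p.1 + x p.2) ^+ 2
    = (odd_perm s)%:R.
Proof.
move=> L2 x_inj Frob_x.
have addLL (y : L) : y + y = 0 := addrr_pchar2 L2 y.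
have sqrLD (y z : L) : (y + z) ^+ 2 = y ^+ 2 + z ^+ 2.
  by rewrite sqrrD mulr2n addLL addr0.
have x_add0 i j : i != j -> x i + x j != 0.
  apply: contra => /eqP H; apply/eqP/x_inj.
  by apply/eqP; rewrite -subr_eq0 (oppr_pchar2 L2) H.
pose g i j := x i / (x i + x j).
have gC i j : i != j -> g i j = g j i + 1.
  by move=> /x_add0 nz; rewrite /g (addrC (x j)) -(divff nz) -mulrDl addrCA addLL addr0.
pose Phi (i j : 'I_n) := if (i < j)%N then g i j else g j i.
have PhiC i j : Phi i j = Phi j i.
  by rewrite /Phi; case: ltngtP => // /val_inj ->.
pose B := \sum_(p : 'I_n * 'I_n | (p.1 < p.2)%N) g p.1 p.2.
have B_perm : \sum_(p : 'I_n * 'I_n | (p.1 < p.2)%N) g (s p.1) (s p.2)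
                = B + (odd_perm s)%:R.
  rewrite (eq_bigr (fun p => Phi (s p.1) (s p.2) + (s p.2 < s p.1)%N%:R)); last first.
    case=> i j /= lt12; rewrite /Phi; case: ltngtP => [|lt|/val_inj/perm_inj ij].
    - by rewrite addr0.
    - by rewrite gC // (inj_eq perm_inj) neq_ltn lt12.
    - by rewrite ij ltnn in lt12.
  rewrite big_split (@big_ltn_pair_perm _ _ _ _ Phi) //=; congr (_ + _).
    by apply: eq_bigr => p; rewrite /Phi => ->.
  rewrite -natr_sum -(odd_inversions s) -[LHS]/(_%:R).
  rewrite -{1}[\sum_(_ | _) _]odd_double_half natrD -mul2n natrM (pcharf0 L2) mul0r addr0 //.
have B_sqr : B ^+ 2 = \sum_(p : 'I_n * 'I_n | (p.1 < p.2)%N) g (s p.1) (s p.2).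
  rewrite -(pFrobenius_autE L2) rmorph_sum; apply: eq_bigr => p _ /=.
  by rewrite /g !(pFrobenius_autE L2) expr_div_n sqrLD !Frob_x.
have := B_sqr; rewrite B_perm => /(congr1 (+%R B)).
rewrite addrA addLL add0r => <-.
rewrite B_sqr /B -big_split; apply: eq_bigr => -[i j] /= lt12.
have nz : x i + x j != 0 by rewrite x_add0 // neq_ltn lt12.
rewrite /g -!Frob_x -sqrLD.
rewrite [x i / _ in RHS](_ : _ = x i * (x i + x j) / (x i + x j) ^+ 2); last by field.
by rewrite -mulrDl mulrDr -expr2 addrC addrAC addLL add0r.
Qed.

(** * Irreducible factors as cycles of Frobenius *)

Lemma F2_sqr (a : 'F_2) : a ^+ 2 = a.
Proof. by case: a => -[|[|]] // ?; apply/val_inj. Qed.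

Lemma F2_pchar (L : fieldType) (iota : {rmorphism 'F_2 -> L}) : 2%N \in [pchar L].
Proof. by rewrite (fmorph_pchar iota) pchar_Fp. Qed.

Lemma map_poly_Frobenius_F2 (L : fieldType) (L2 : 2%N \in [pchar L])
    (iota : {rmorphism 'F_2 -> L}) (p : {poly 'F_2}) :
  map_poly (pFrobenius_aut L2) (map_poly iota p) = map_poly iota p.
Proof.
apply/polyP=> k; rewrite !coef_map /= (pFrobenius_autE L2).
by rewrite -rmorphXn F2_sqr.
Qed.

(** The coefficients of [p] satisfy c ^ 2 = c, hence are 0 or 1. *)
Lemma Frobenius_descent (L : fieldType) (L2 : 2%N \in [pchar L])
    (iota : {rmorphism 'F_2 -> L}) (p : {poly L}) :
    map_poly (pFrobenius_aut L2) p = p ->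
  exists q : {poly 'F_2}, map_poly iota q = p.
Proof.
move=> Frob_p; exists (map_poly (fun c => (c != 0)%:R) p).
apply/polyP=> k; rewrite coef_map coef_map_id0 ?eqxx //= rmorph_nat.
have : p`_k ^+ 2 = p`_k by rewrite -[in RHS]Frob_p coef_map /= pFrobenius_autE.
have [-> // | nz] := eqVneq p`_k 0.
by rewrite expr2 -[in X in _ = X](mulr1 p`_k) => /(mulfI nz) ->.
Qed.

Lemma root_Frobenius_orbit (L : fieldType) (iota : {rmorphism 'F_2 -> L})
    (p : {poly 'F_2}) (n : nat) (x : 'I_n -> L) (s : 'S_n) (i j : 'I_n) :
    (forall i, x i ^+ 2 = x (s i)) -> j \in porbit s i ->
  root (map_poly iota p) (x i) -> root (map_poly iota p) (x j).
Proof.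
move=> Frob_x /porbitP[k ->] px; have L2 := F2_pchar iota.
elim: k => [|k IHk]; first by rewrite perm1.
rewrite expgSr permM -Frob_x -(pFrobenius_autE L2).
rewrite -(map_poly_Frobenius_F2 L2); exact: rmorph_root.
Qed.

(** The product of the [X - x i] over a cycle of [s] is fixed by Frobenius, so has
coefficients in 'F_2. It is irreducible there, because a factor over 'F_2 that
has one root in the cycle has all of them. *)
Lemma num_irr_factors_porbits (L : fieldType) (iota : {rmorphism 'F_2 -> L})
    (f : {poly 'F_2}) (n : nat) (x : 'I_n -> L) (s : 'S_n) :
    injective x -> map_poly iota f = \prod_i ('X - (x i)%:P) ->
    (forall i, x i ^+ 2 = x (s i)) ->
  num_irr_factors f = #|porbits s|.
Proof.
move=> x_inj split_f Frob_x; have L2 := F2_pchar iota.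
pose P (C : {set 'I_n}) := \prod_(i in C) ('X - (x i)%:P).
have exq C : exists q, (C \in porbits s) ==> (map_poly iota q == P C).
  have [/imsetP[y _ ->] | _] := boolP (C \in porbits s); last by exists 0.
  suff [r def_r]: exists r, map_poly iota r = P (porbit s y) by exists r; rewrite def_r eqxx.
  apply: (@Frobenius_descent L L2).
  rewrite /P rmorph_prod /= [RHS](reindex_inj (@perm_inj _ s)) /=.
  apply: eq_big => [i | i _].
    by rewrite -!eq_porbit_mem (porbit_perm s 1).
  by rewrite map_polyXsubC /= pFrobenius_autE Frob_x.
pose q C := xchoose (exq C).
have qP C : C \in porbits s -> map_poly iota (q C) = P C.
  by move=> sC; apply/eqP; have /implyP := xchooseP (exq C); apply.
have f0 : f != 0.
  rewrite -(map_poly_eq0 iota) split_f; apply/prodf_neq0 => i _.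
  by rewrite polyXsubC_eq0.
rewrite (@num_irr_factorsE _ f [seq q C | C <- enum (porbits s)]) //.
  by rewrite size_map -cardE.
apply/irr_factorizationP; split=> [_ /mapP[C + ->]|]; last first.
  rewrite big_map big_enum /= -(eqp_map iota) rmorph_prod /= split_f.
  rewrite (partition_big_imset (porbit s)) /=.
  rewrite (eq_bigr (fun C => map_poly iota (q C))) ?eqpxx // => C sC.
  rewrite qP //; case/imsetP: sC => y _ ->.
  by apply: eq_bigl => i; rewrite eq_porbit_mem.
rewrite mem_enum => sC; have szq : size (q C) = #|C|.+1.
  by rewrite -(size_map_poly iota) qP // /P -big_enum /= size_prod_XsubC -cardE.
split=> [|p p1 p_q].
  rewrite szq ltnS; case/imsetP: sC => y _ ->.
  by rewrite card_gt0; apply/set0Pn; exists y; exact: porbit_id.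
rewrite -(eqp_map iota) /eqp !dvdp_map p_q /= -(dvdp_map iota) qP //.
have [i iC pi] : exists2 i, i \in C & root (map_poly iota p) (x i).
  have : map_poly iota p %| P C by rewrite -qP // dvdp_map.
  rewrite /P -big_enum => /dvdp_prod_XsubC[m].
  case def_m: (mask m _) => [|i r] p_m.
    case/negP: p1; rewrite -(size_map_poly iota) (eqp_size p_m).
    by rewrite big_nil size_poly1.
  exists i; first by rewrite -mem_enum (mem_mask (m := m)) // def_m mem_head.
  by rewrite (eqp_root p_m) big_cons rootM root_XsubC eqxx.
rewrite /P -big_enum; rewrite -(big_map x predT (fun c => 'X - c%:P)).
apply: uniq_roots_dvdp; last first.
  by rewrite uniq_rootsE map_inj_uniq // enum_uniq.
apply/allP=> _ /mapP[j + ->]; rewrite mem_enum => jC.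
apply: root_Frobenius_orbit pi => //.
case/imsetP: sC iC jC => y _ ->; rewrite -!eq_porbit_mem => /eqP iy /eqP jy.
by rewrite iy jy.
Qed.

(** * The Stickelberger-Swan theorem *)

Lemma symmetric_pair_prod (K : comNzRingType) (n : nat) (Phi : 'I_n -> 'I_n -> {mpoly K[n]}) :
    (forall i j, Phi i j = Phi j i) ->
    (forall (s : 'S_n) i j, msym s (Phi i j) = Phi (s i) (s j)) ->
  \prod_(p : 'I_n * 'I_n | (p.1 < p.2)%N) Phi p.1 p.2 \is symmetric.
Proof.
move=> PhiC Phi_s; apply/issymP => s; rewrite rmorph_prod /=.
by rewrite -(big_ltn_pair_perm _ s PhiC); apply: eq_bigr => p _.
Qed.

Lemma msymXU (K : comNzRingType) (n : nat) (s : 'S_n) (i : 'I_n) :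
  msym s 'X_i = 'X_(s i) :> {mpoly K[n]}.
Proof. by rewrite /msym mmapX mmap1U. Qed.

(** The polynomial [g] is a pencil that contains both the discriminant, at -4, and
the square of [c], at 0; its linear coefficient modulo 2 is the numerator of the
sum of [Frobenius_parity]. Knowing that its value at 0 is the square of an
integer, and not just an integer, is what determines it modulo 8. *)
Lemma disc_pencil (n : nat) (F : {poly int}) :
  exists (c : int) (g : {poly int}), forall (R : idomainType) (x : 'I_n -> R),
    map_poly intr F = \prod_i ('X - (x i)%:P) ->
    \prod_(p : 'I_n * 'I_n | (p.1 < p.2)%N) (x p.1 + x p.2) = c%:~R /\
    \prod_(p : 'I_n * 'I_n | (p.1 < p.2)%N)
       (((x p.1 + x p.2) ^+ 2)%:P + (x p.1 * x p.2)%:P * 'X) = map_poly intr g.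
Proof.
pose PhiS (i j : 'I_n) : {mpoly int[n]} := 'X_i + 'X_j.
have [|c cE] := @symmetric_eval _ _
    (\prod_(p : 'I_n * 'I_n | (p.1 < p.2)%N) PhiS p.1 p.2) F.
  apply: symmetric_pair_prod => [i j | s i j]; first exact: addrC.
  by rewrite /PhiS rmorphD /= !msymXU.
pose PhiG (i j : 'I_n) : {mpoly {poly int}[n]} :=
  ('X_i + 'X_j) ^+ 2 + 'X_i * 'X_j * ('X : {poly int})%:MP.
(* The indeterminate of the pencil is a coefficient: take {poly int} as the ring
   of coefficients. *)
have [|g gE] := @symmetric_eval _ _
    (\prod_(p : 'I_n * 'I_n | (p.1 < p.2)%N) PhiG p.1 p.2) (map_poly polyC F).
  apply: symmetric_pair_prod => [i j | s i j].
    by rewrite /PhiG (addrC 'X_i 'X_j) (mulrC 'X_i 'X_j).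
  rewrite /PhiG rmorphD rmorphXn !rmorphM rmorphD /= !msymXU.
  by rewrite /msym mmapC.
exists c, g => R x Fx; split.
  rewrite -(cE R intr x Fx) rmorph_prod; apply: eq_bigr => p _.
  by rewrite /= /PhiS rmorphD /= !mmapX !mmap1U.
rewrite -(gE {poly R} (map_poly intr) (fun i => (x i)%:P)); last first.
  rewrite -map_poly_comp (eq_map_poly (g := polyC \o intr)); last first.
    by move=> a /=; rewrite map_polyC.
  rewrite map_poly_comp Fx rmorph_prod; apply: eq_bigr => i _ /=.
  by rewrite map_polyXsubC.
rewrite rmorph_prod; apply: eq_bigr => p _ /=.
rewrite /PhiG rmorphD rmorphXn !rmorphM rmorphD /= !mmapX !mmap1U mmapC.
by rewrite /= map_polyX rmorphD /= !mmapX !mmap1U expr2.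
Qed.

Lemma prod_pencil_coef1 (L : fieldType) (I : finType) (P : pred I) (a b : I -> L) :
    (forall i, P i -> a i != 0) ->
  (\prod_(i | P i) ((a i)%:P + (b i)%:P * 'X))`_1
    = (\prod_(i | P i) a i) * \sum_(i | P i) b i / a i.
Proof.
move=> a0.
rewrite (eq_bigr (fun i => (a i)%:P * (1 + (b i / a i)%:P * 'X))); last first.
  by move=> i Pi; rewrite mulrDr mulr1 mulrA -polyCM mulrCA divff ?a0 // mulr1.
rewrite big_split /= -rmorph_prod /= coefCM.
suff [_ ->] : (\prod_(i | P i) (1 + (b i / a i)%:P * 'X))`_0 = 1 /\
    (\prod_(i | P i) (1 + (b i / a i)%:P * 'X))`_1 = \sum_(i | P i) b i / a i.
  by [].
elim/big_rec2: _ => [|i s q _ [q0 q1]]; first by rewrite !coefC.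
by rewrite mulrDl mul1r -mulrA !coefD !coefCM !coefXM q0 q1 mulr0 addr0 mulr1 addrC.
Qed.

Lemma horner_mod_sqr (g : {poly int}) (z : int) :
  exists r, g.[z] = g`_0 + g`_1 * z + r * z ^+ 2.
Proof.
exists (drop_poly 2 g).[z]; rewrite -{1}(poly_take_drop 2 g) hornerD hornerM hornerXn.
by rewrite horner_poly !big_ord_recr big_ord0 /= add0r expr0 mulr1 expr1.
Qed.

Lemma pchar2_intr_odd (L : fieldType) (c : int) :
  2%N \in [pchar L] -> c%:~R = (odd `|c|)%:R :> L.
Proof.
move=> L2; have N k : k%:R = (odd k)%:R :> L.
  by rewrite -{1}[k]odd_double_half natrD -mul2n natrM (pcharf0 L2) mul0r addr0.
case: c => k; first exact: N.
by rewrite [X in X%:~R]NegzE mulrNz (oppr_pchar2 L2); exact: N.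
Qed.

(** The discriminant of the lift is g(-4) = c ^ 2 - 4 g_1 modulo 16 for the pencil [g]
of [disc_pencil]. In characteristic 2, [c] becomes a product of sums of distinct
roots, hence is odd, and g_1 becomes the parity of the Frobenius permutation. *)
Theorem Stickelberger_Swan (n : nat) (F : {poly int}) (f : {poly 'F_2}) (x : 'I_n -> algC) :
    map_poly intr F = f -> separable_poly f ->
    map_poly intr F = \prod_i ('X - (x i)%:P) ->
  exists d : int,
    \prod_(p : 'I_n * 'I_n | (p.1 < p.2)%N) (x p.1 - x p.2) ^+ 2 = d%:~R /\
    (d = 1 + 4 * (n + num_irr_factors f)%:Z %[mod 8])%Z.
Proof.
move=> def_f sep_f split_F.
have F_monic : F \is monic.
  apply/eqP/(@intr_inj algC); rewrite -lead_coef_map_inj //; last exact: intr_inj.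
  by rewrite split_F; apply/eqP; apply: monic_prod => i _; apply: monicXsubC.
have szF : size F = n.+1.
  rewrite -(size_map_inj_poly (@intr_inj algC)) // split_F -big_enum /=.
  by rewrite size_prod_XsubC size_enum_ord.
have f_monic : f \is monic by rewrite -def_f monic_map.
have szf : size f = n.+1.
  by rewrite -def_f size_map_poly_id0 // (eqP F_monic).
have [c [g cgE]] := disc_pencil n F.
have [Sx Gx] := cgE _ x split_F.
exists g.[-4]; split.
  transitivity (map_poly intr g).[(-4)%:~R : algC]; last by rewrite horner_map.
  rewrite -Gx horner_prod; apply: eq_bigr => p _.
  rewrite !hornerE /= mulrNz; ring.
(* The Frobenius permutation [s] of the roots [y i] of [f]. *)
have [L [rs f_rs _]] := FinSplittingFieldFor (monic_neq0 f_monic).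
pose iota : {rmorphism 'F_2 -> L} := in_alg L.
have L2 := F2_pchar iota.
have split_f : map_poly iota f = \prod_(z <- rs) ('X - z%:P).
  by apply/eqP; rewrite -eqp_monic ?monic_map ?monic_prod_XsubC.
have sz_rs : size rs = n.
  by apply/succn_inj; rewrite -(size_prod_XsubC rs id) -split_f size_map_poly.
have rs_uniq : uniq rs by rewrite -separable_prod_XsubC -split_f separable_map.
pose y (i : 'I_n) : L := rs`_i.
have y_inj : injective y.
  by move=> i j /eqP; rewrite nth_uniq ?sz_rs // => /eqP/val_inj.
have split_y : map_poly iota f = \prod_i ('X - (y i)%:P).
  by rewrite split_f (big_nth 0) big_mkord sz_rs.
have next i : exists j, y i ^+ 2 == y j.
  have : root (map_poly iota f) (y i ^+ 2).
    rewrite -(pFrobenius_autE L2) -(map_poly_Frobenius_F2 L2); apply: rmorph_root.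
    by rewrite split_f root_prod_XsubC mem_nth ?sz_rs.
  rewrite split_f root_prod_XsubC => /(nthP 0)[j]; rewrite sz_rs => ltjn <-.
  by exists (Ordinal ltjn).
pose t i := xchoose (next i).
have tE i : y i ^+ 2 = y (t i) by apply/eqP; exact: (xchooseP (next i)).
have t_inj : injective t.
  move=> i j ij; apply/y_inj/(fmorph_inj (pFrobenius_aut L2)).
  by rewrite /= !(pFrobenius_autE L2) !tE ij.
pose s := perm t_inj.
have sE i : y i ^+ 2 = y (s i) by rewrite permE tE.
have := num_irr_factors_porbits y_inj split_y sE => ->.
have FL : map_poly intr F = \prod_i ('X - (y i)%:P).
  rewrite -split_y -def_f -map_poly_comp; apply: eq_map_poly => a /=.
  exact: esym (rmorph_int iota a).
(* Modulo 2, [c] is the nonzero product of the y i + y j, and [g`_1] is the parity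
   of [s]. *)
have [Sy Gy] := cgE _ y FL.
have y_add0 (p : 'I_n * 'I_n) : (p.1 < p.2)%N -> (y p.1 + y p.2) != 0.
  move=> lt12; apply/eqP => H; have /y_inj E : y p.1 = y p.2.
    by apply/eqP; rewrite -subr_eq0 (oppr_pchar2 L2) H.
  by rewrite E ltnn in lt12.
have c_odd : odd `|c|.
  have : c%:~R != 0 :> L by rewrite -Sy; apply/prodf_neq0 => p /y_add0.
  by rewrite (pchar2_intr_odd c L2); case: odd => //; rewrite eqxx.
have y2_add0 (p : 'I_n * 'I_n) : (p.1 < p.2)%N -> (y p.1 + y p.2) ^+ 2 != 0.
  by move/y_add0; rewrite expf_eq0.
have := prod_pencil_coef1 (fun p => y p.1 * y p.2) y2_add0.
rewrite (Frobenius_parity L2 y_inj sE) Gy coef_map /=.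
rewrite prodrXl Sy !(pchar2_intr_odd _ L2) c_odd expr1n mul1r => g1.
have {}g1 : odd `|g`_1| = s.
  move: g1; case: (odd _); case: (odd_perm s) => /eqP //; rewrite ?oner_eq0 //.
  by rewrite eq_sym oner_eq0.
have g0 : g`_0 = c ^+ 2.
  apply/(@intr_inj algC); rewrite -coef_map -Gx -horner_coef0 horner_prod.
  rewrite rmorphXn /= -Sx -prodrXl; apply: eq_bigr => p _.
  by rewrite !hornerE.
(* The conclusion is c ^ 2 - 4 g_1 = 1 + 4 (n + t) modulo 8, where g_1 has the
   parity of [s], which is that of n + t. *)
have [r ->] := horner_mod_sqr g (-4).
rewrite g0; move: g1 c_odd; rewrite /odd_perm card_ord.
move: (#|_|) (g`_1) => k u; clear => u_odd c_odd.
have [v def_v] : exists v : int, u = (n + k)%:Z + 2 * v.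
  exists ((u - (n + k)%:Z) %/ 2)%Z; lia.
have [w def_c] : exists w : int, c = 2 * w + 1.
  exists (c %/ 2)%Z; lia.
have [m def_m] : exists m : int, w * (w + 1) = 2 * m.
  have [w0 | w1] : w = 2 * (w %/ 2)%Z \/ w = 2 * (w %/ 2)%Z + 1 by lia.
    by exists ((w %/ 2)%Z * (w + 1)); rewrite {1}w0; ring.
  by exists (w * ((w %/ 2)%Z + 1)); rewrite [in LHS]mulrC {1}w1; ring.
have -> : c ^+ 2 = 8 * m + 1.
  transitivity (4 * (2 * m) + 1); last by ring.
  by rewrite -def_m def_c; ring.
rewrite def_v; lia.
Qed.

(** * Discriminants and power sums *)

Lemma prod_deriv_root (R : comNzRingType) (n : nat) (x : 'I_n -> R) :
  let F := \prod_i ('X - (x i)%:P) in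
  \prod_i F^`().[x i]
    = (-1) ^+ 'C(n, 2) * \prod_(p : 'I_n * 'I_n | (p.1 < p.2)%N) (x p.1 - x p.2) ^+ 2.
Proof.
move=> F; have dF i : F^`().[x i] = \prod_(j | j != i) (x i - x j).
  rewrite /F (bigD1 i) //= derivM derivXsubC mul1r hornerD hornerM hornerXsubC subrr.
  by rewrite mul0r addr0 horner_prod; apply: eq_bigr => j _; rewrite hornerXsubC.
rewrite (eq_bigr _ (fun i _ => dF i)).
(* Each pair i < j contributes (x i - x j) (x j - x i) = - (x i - x j) ^ 2. *)
transitivity (\prod_(i < n) ((\prod_(j : 'I_n | (i < j)%N) (x i - x j))
    * \prod_(j : 'I_n | (j < i)%N) (x i - x j))).
  apply: eq_bigr => i _; rewrite (bigID (fun j : 'I_n => (i < j)%N)) /=; congr (_ * _).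
    by apply: eq_bigl => j; rewrite neq_ltn; case: ltngtP.
  by apply: eq_bigl => j; rewrite neq_ltn; case: ltngtP.
rewrite big_split /= [X in _ * X](exchange_big_dep xpredT) //= -big_split /=.
rewrite -card_ltn_pairs -prodr_const -big_split /=.
under eq_bigr => i _ do rewrite -big_split /=.
rewrite pair_big_dep /=; apply: eq_bigr => p _; ring.
Qed.

Lemma reverse_prod_XsubC (R : comNzRingType) (n : nat) (x : 'I_n -> R) :
  \prod_i (1 - (x i)%:P * 'X) = \poly_(j < n.+1) (\prod_i ('X - (x i)%:P))`_(n - j).
Proof.
elim: n x => [|n IHn] x.
  rewrite !big_ord0; apply/polyP => k; rewrite coef_poly coefC.
  by case: k => [|k]; rewrite ?coef1.
rewrite !big_ord_recr /= IHn; set p := \prod_(i < n) _; set c := x _.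
have szp : size p = n.+1 by rewrite /p -big_enum /= size_prod_XsubC size_enum_ord.
apply/polyP => k; rewrite mulrBr mulr1 coefB mulrCA coefCM coefMX !coef_poly.
rewrite mulrBr coefB coefMX [p * c%:P]mulrC coefCM.
case: k => [|k] /=.
  by rewrite !subn0 mulr0 [p`_n.+1]nth_default ?szp // mulr0.
rewrite !ltnS subSS; case: (ltngtP k n) => [lt_kn | lt_nk | ->].
- by rewrite subn_eq0 leqNgt lt_kn /= subnS.
- by rewrite mulr0 subr0.
- by rewrite subnn.
Qed.

Lemma deriv_prod (R : comNzRingType) (I : finType) (a : I -> {poly R}) :
  (\prod_i a i)^`() = \sum_i (a i)^`() * \prod_(j | j != i) a j.
Proof.
have: uniq (index_enum I) by exact: index_enum_uniq.
elim: (index_enum I) => [|i r IHr] /=; first by rewrite !big_nil derivC.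
case/andP=> ir /IHr{}IHr; rewrite !big_cons derivM IHr eqxx /=; congr (_ * _ + _).
  rewrite big_seq [RHS]big_seq_cond; apply: eq_bigl => j.
  by case: eqVneq => [->|]; rewrite ?(negPf ir) ?andbT.
rewrite mulr_sumr !big_seq; apply: eq_bigr => j jr; rewrite big_cons.
by case: eqVneq jr ir => [-> -> //|_ _ _]; rewrite mulrCA.
Qed.

(** Newton's identities, for all [k] at once: with A_i = A / (1 - x_i X), both
n A - X A' and A * sum_i 1 / (1 - x_i X) are the sum of the A_i. The power series
are truncated at X^N. *)
Lemma Newton_identity (R : comNzRingType) (n : nat) (x : 'I_n -> R) (N k : nat) :
  (k < N)%N ->
  let A := \prod_i (1 - (x i)%:P * 'X) in
  (A * \poly_(j < N) \sum_i x i ^+ j)`_k = A`_k *+ n - A`_k *+ k.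
Proof.
move=> ltkN A; pose a i := 1 - (x i)%:P * 'X; pose A_ i := \prod_(j | j != i) a j.
have AE i : A = a i * A_ i by rewrite /A (bigD1 i).
have dA : 'X * A^`() = A *+ n - \sum_i A_ i.
  have -> : A *+ n = \sum_(i < n) A by rewrite sumr_const card_ord.
  rewrite deriv_prod mulr_sumr -sumrB.
  apply: eq_bigr => i _; rewrite {1}(AE i) -/(A_ i) /a derivB derivC deriv_mulC derivX.
  ring.
have -> : A * \poly_(j < N) \sum_i x i ^+ j
    = \sum_i A_ i - (\sum_i (x i ^+ N)%:P * A_ i) * 'X^N.
  have -> : \poly_(j < N) \sum_i x i ^+ j = \sum_i \sum_(j < N) ((x i)%:P * 'X) ^+ j.
    rewrite poly_def exchange_big; apply: eq_bigr => j _ /=.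
    rewrite scaler_suml; apply: eq_bigr => i _.
    by rewrite exprMn -polyC_exp mul_polyC.
  rewrite mulr_sumr mulr_suml -sumrB; apply: eq_bigr => i _.
  have := subrX1 ((x i)%:P * 'X) N; rewrite exprMn -polyC_exp => geo.
  rewrite {1}(AE i) /a; move: geo; set G := \sum_(j < N) _ => geo.
  transitivity (A_ i * - (((x i)%:P * 'X - 1) * G)); first by ring.
  by rewrite -geo; ring.
rewrite coefB coefMXn ltkN subr0.
have -> : \sum_i A_ i = A *+ n - 'X * A^`() by rewrite dA subKr.
rewrite coefB coefMn coefXM coef_deriv; case: k {ltkN} => [|k] //=.
Qed.

(** Here e is the second elementary symmetric function of [y]; the first equation
determines it from the first two power sums, so that these give the product
modulo 8. *)
Lemma sum_prod_mod8 (I : finType) (y : I -> algC) :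
    (forall i, y i \in Aint) ->
  exists e w : algC, [/\ e \in Aint, w \in Aint,
    (\sum_i y i) ^+ 2 - \sum_i y i ^+ 2 = 2 * e
    & \prod_i (1 + 2 * y i) = 1 + 2 * \sum_i y i + 4 * e + 8 * w].
Proof.
move=> yZ; have two : (2 : algC) \in Aint by exact: rpred_nat.
have: all (fun i => y i \in Aint) (index_enum I) by apply/allP.
elim: (index_enum I) => [|i r IHr] /=.
  by exists 0, 0; rewrite !big_nil !rpred0; split=> //; ring.
case/andP=> yiZ yrZ; have [e [w [eZ wZ def_e def_w]]] := IHr yrZ.
have sZ : \sum_(j <- r) y j \in Aint by exact: rpred_sum.
rewrite !big_cons; move: (\sum_(j <- r) y j) sZ def_e def_w => S SZ def_e ->.
exists (e + y i * S), (w + y i * e + 2 * (y i * w)); split.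
- by rewrite rpredD ?rpredM.
- by rewrite !rpredD ?rpredM // ?rpredM.
- by rewrite mulrDr -def_e; ring.
- by ring.
Qed.

(** * The pentanomial *)

Definition pentanomial (R : comNzRingType) (n s : nat) : {poly R} :=
  'X^n + 'X^(n - s) + 'X^(n - 2 * s) + 'X^(n - 3 * s) + 1.

Lemma map_pentanomial (R : comNzRingType) (n s : nat) :
  map_poly intr (pentanomial int n s) = pentanomial R n s.
Proof. by rewrite /pentanomial !rmorphD !rmorph1 /= !map_polyXn. Qed.

Lemma size_pentanomial (R : comNzRingType) (n s : nat) :
  (0 < s)%N -> (3 * s < n)%N -> size (pentanomial R n s) = n.+1.
Proof.
move=> s_gt0 n_gt3s; rewrite /pentanomial -!addrA size_polyDl size_polyXn // ltnS.
apply/leq_sizeP => k le_nk.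
have k_neq j : (j < n)%N -> (k == j)%N = false by move=> ?; apply/eqP; lia.
by rewrite !coefD !coefXn coef1 !k_neq ?addr0 //; lia.
Qed.

Lemma pentanomial_monic (R : comNzRingType) (n s : nat) :
  (0 < s)%N -> (3 * s < n)%N -> pentanomial R n s \is monic.
Proof.
move=> s_gt0 n_gt3s; rewrite monicE lead_coefE size_pentanomial //= !coefD !coefXn.
have n_neq j : (j < n)%N -> (n == j)%N = false by move=> ?; apply/eqP; lia.
by rewrite coef1 eqxx !n_neq ?addr0 //; lia.
Qed.

Lemma root_pentanomial (R : comNzRingType) (n s : nat) (z : R) :
  root (pentanomial R n s) z =
    (z ^+ n + z ^+ (n - s) + z ^+ (n - 2 * s) + z ^+ (n - 3 * s) + 1 == 0).
Proof. by rewrite rootE !hornerE. Qed.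

(** All the nonzero exponents are odd, so [f = X * f^`() + 1] modulo 2. *)
Lemma pentanomial_separable (n s : nat) :
  ~~ odd s -> odd n -> (3 * s < n)%N -> separable_poly (pentanomial 'F_2 n s).
Proof.
move=> s_even n_odd n_gt3s.
have XdXn k : odd k -> 'X * 'X^k^`() = 'X^k :> {poly 'F_2}.
  move=> k_odd; rewrite derivXn mulrnAr -exprS prednK; last by case: k k_odd.
  rewrite -mulr_natl -{1}[k]odd_double_half k_odd natrD -mul2n natrM.
  rewrite (pcharf0 (_ : 2%N \in [pchar {poly _}])) ?pchar_poly ?pchar_Fp //.
  by rewrite mul0r addr0 mul1r.
rewrite separable_poly.unlock; apply/Bezout_coprimepP; exists (1, - 'X) => /=.
rewrite mul1r mulNr !derivD derivC addr0 !mulrDr !XdXn //; try lia.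
by rewrite /pentanomial addrC addKr eqpxx.
Qed.

Lemma deriv_root_pentanomial (R : comNzRingType) (n s : nat) (z : R) :
  (3 * s < n)%N -> root (pentanomial R n s) z ->
  z * (pentanomial R n s)^`().[z]
    = - (n%:R + s%:R * (z ^+ (n - s) + 2 * z ^+ (n - 2 * s) + 3 * z ^+ (n - 3 * s))).
Proof.
move=> n_gt3s; rewrite root_pentanomial => /eqP root_z.
have zdXk k : (0 < k)%N -> z * ('X^k^`()).[z] = k%:R * z ^+ k.
  by move=> k_gt0; rewrite derivXn hornerMn hornerXn mulrnAr -exprS prednK // mulr_natl.
rewrite !derivD derivC !hornerD hornerC addr0 !mulrDr !zdXk; try lia.
rewrite !natrB; try lia.
rewrite !natrM; move: root_z.
set z0 := z ^+ n; set z1 := z ^+ _; set z2 := z ^+ _; set z3 := z ^+ _ => root_z.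
have -> : z0 = - (z1 + z2 + z3 + 1) by apply/eqP; rewrite -subr_eq0 -root_z; apply/eqP; ring.
ring.
Qed.

Lemma reverse_pentanomial (R : comNzRingType) (n s : nat) (x : 'I_n -> R) :
    (3 * s < n)%N -> pentanomial R n s = \prod_i ('X - (x i)%:P) ->
  \prod_i (1 - (x i)%:P * 'X) = 1 + 'X^s + 'X^(2 * s) + 'X^(3 * s) + 'X^n.
Proof.
move=> n_gt3s split_x; rewrite reverse_prod_XsubC -split_x; apply/polyP => k.
rewrite coef_poly !coefD !coef1 !coefXn; case: ltnP => [le_kn | lt_nk].
  have -> : (n - k == n)%N = (k == 0)%N by apply/eqP/eqP; lia.
  have sub_eq j : (3 * s < n -> j <= 3 * s -> (n - k == n - j) = (k == j))%N.
    by move=> *; apply/eqP/eqP; lia.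
  rewrite !sub_eq; try lia.
  by have -> : (n - k == 0)%N = (k == n)%N by apply/eqP/eqP; lia.
have k_neq j : (j <= n)%N -> (k == j)%N = false by move=> ?; apply/eqP; lia.
by rewrite !k_neq ?addr0 //; lia.
Qed.

(** * Power sums of the roots of the pentanomial *)

(** The recurrence given by Newton's identities; power sums of negative index are
replaced by 0. *)
Lemma Newton_pentanomial (R : comNzRingType) (n s : nat) (x : 'I_n -> R) :
  let A := 1 + 'X^s + 'X^(2 * s) + 'X^(3 * s) + 'X^n : {poly R} in
  let p k := \sum_i x i ^+ k in
  let p_sub k m := if (k < m)%N then 0 else p (k - m)%N in
    \prod_i (1 - (x i)%:P * 'X) = A ->
  forall k, p k + p_sub k s + p_sub k (2 * s)%N + p_sub k (3 * s)%N + p_sub k n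
    = A`_k *+ n - A`_k *+ k.
Proof.
move=> A p p_sub split_A k; have := Newton_identity x (ltnSn k).
rewrite /= split_A => <-; rewrite /A !mulrDl mul1r !coefD !coefXnM !coef_poly ltnSn.
have lt_sub m : (k - m < k.+1)%N by rewrite ltnS leq_subr.
by rewrite !lt_sub.
Qed.

(** Below [n], the recurrence only involves exponents that differ by multiples of
[s], and it starts from the exponent 0. *)
Lemma power_sum_not_dvd (R : comNzRingType) (n s : nat) (x : 'I_n -> R) (k : nat) :
    (0 < s)%N ->
    \prod_i (1 - (x i)%:P * 'X) = 1 + 'X^s + 'X^(2 * s) + 'X^(3 * s) + 'X^n ->
  (k < n)%N -> ~~ (s %| k)%N -> \sum_i x i ^+ k = 0.
Proof.
move=> s_gt0 split_A; have [N] := ubnP k; elim: N k => // N IHN k ltkN lt_kn s'k.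
have := Newton_pentanomial split_A k.
have sk j : (k == j * s)%N = false.
  by apply: contraNF s'k => /eqP->; rewrite dvdn_mull.
have k0 : (k == 0)%N = false by rewrite -[0%N]/(0 * s)%N sk.
have k1 : (k == s)%N = false by rewrite -[X in k == X]mul1n sk.
rewrite !coefD coef1 !coefXn k0 k1 !sk (ltn_eqF lt_kn) !addr0 !mul0rn subr0 lt_kn addr0.
have IH j : (if (k < j.+1 * s)%N then 0 else \sum_i x i ^+ (k - j.+1 * s)) = 0.
  case: ltnP => // le_jk; apply: IHN.
  - rewrite ltnS in ltkN; apply: leq_trans ltkN.
    by rewrite ltn_subrL muln_gt0 s_gt0 /= lt0n k0.
  - by rewrite (leq_ltn_trans _ lt_kn) ?leq_subr.
  - by rewrite dvdn_subl // dvdn_mull.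
by have := IH 0%N; rewrite mul1n => ->; rewrite !IH !addr0.
Qed.

Lemma power_sum_odd (R : comNzRingType) (n s : nat) (x : 'I_n -> R) (k : nat) :
    (0 < s)%N -> ~~ odd s ->
    \prod_i (1 - (x i)%:P * 'X) = 1 + 'X^s + 'X^(2 * s) + 'X^(3 * s) + 'X^n ->
  (k < n)%N -> odd k -> \sum_i x i ^+ k = 0.
Proof.
move=> s_gt0 s_even split_A lt_kn k_odd; apply: (power_sum_not_dvd s_gt0 split_A) => //.
by apply/negP => /dvdnP[j jk]; rewrite jk oddM (negPf s_even) andbF in k_odd.
Qed.

(** Subtracting the recurrences at 2 n - 2 s and at 2 n - 3 s telescopes: it amounts
to multiplying 1 + X^s + X^(2s) + X^(3s) by 1 - X^s. The terms that come from
X^n are the power sums of the odd exponents n - 2 s and n - 3 s. *)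
Lemma power_sum_double (R : comNzRingType) (n s : nat) (x : 'I_n -> R) :
    (0 < s)%N -> ~~ odd s -> odd n -> (3 * s < n)%N ->
    \prod_i (1 - (x i)%:P * 'X) = 1 + 'X^s + 'X^(2 * s) + 'X^(3 * s) + 'X^n ->
  \sum_i x i ^+ (2 * (n - s)) = \sum_i x i ^+ (2 * (n - 3 * s)).
Proof.
move=> s_gt0 s_even n_odd n_gt3s split_A.
have R1 := Newton_pentanomial split_A (2 * (n - s)).
have R2 := Newton_pentanomial split_A (2 * (n - s) - s).
have geq_F (k m : nat) : (m <= k)%N -> (k < m)%N = false by move=> ?; lia.
have coef0 k : (3 * s < k)%N -> ~~ odd k ->
  (1 + 'X^s + 'X^(2 * s) + 'X^(3 * s) + 'X^n : {poly R})`_k = 0.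
  move=> lt_k k_even; rewrite !coefD coef1 !coefXn.
  by do 5!(case: eqP => [?|_]; first lia); rewrite !addr0.
rewrite coef0 ?mul0rn ?subr0 in R1; try lia.
rewrite coef0 ?mul0rn ?subr0 in R2; try lia.
rewrite !geq_F in R1; try lia.
rewrite !geq_F in R2; try lia.
rewrite (_ : 2 * (n - s) - s - s = 2 * (n - s) - 2 * s)%N in R2; last lia.
rewrite (_ : 2 * (n - s) - s - 2 * s = 2 * (n - s) - 3 * s)%N in R2; last lia.
rewrite (_ : 2 * (n - s) - s - 3 * s = 2 * (n - 3 * s))%N in R2; last lia.
have podd k := @power_sum_odd _ _ _ _ k s_gt0 s_even split_A.
rewrite (podd (2 * (n - s) - n)%N) in R1; try lia.
rewrite (podd (2 * (n - s) - s - n)%N) in R2; try lia.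
have := etrans R1 (esym R2); rewrite !addr0.
set p1 := \sum_i _; set p2 := \sum_i _; set p3 := \sum_i _; set p4 := \sum_i _.
by rewrite -!addrA [RHS]addrA [RHS]addrA [RHS]addrC -!addrA => /addIr.
Qed.

(** * The discriminant of the pentanomial modulo 8 *)

(** For h = X^(n-s) + 2 X^(n-2s) + 3 X^(n-3s), modulo 4, h ^ 2 is X^(2(n-s)) + X^(2(n-3s)) + 2 X^(2(n-2s)), because
(n - s) + (n - 3 s) = 2 (n - 2 s). The first two of these three power sums are equal,
and all are even: modulo 2 they are the squares of power sums with odd exponents
below [n], which vanish. *)
Lemma pentanomial_sum_sqr (n s : nat) (x : 'I_n -> algC) :
    (0 < s)%N -> ~~ odd s -> odd n -> (3 * s < n)%N -> (forall i, x i \in Aint) ->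
    \prod_i (1 - (x i)%:P * 'X) = 1 + 'X^s + 'X^(2 * s) + 'X^(3 * s) + 'X^n ->
  exists2 v, v \in Aint &
    \sum_i (x i ^+ (n - s) + 2 * x i ^+ (n - 2 * s) + 3 * x i ^+ (n - 3 * s)) ^+ 2
      = 4 * v.
Proof.
move=> s_gt0 s_even n_odd n_gt3s xZ split_A.
have natZ k : (k%:R : algC) \in Aint by exact: rpred_nat.
have even_sum k : odd k -> (k < n)%N ->
    exists2 e, e \in Aint & \sum_i x i ^+ (2 * k) = 2 * e.
  move=> k_odd lt_kn.
  have [e [_ [eZ _ + _]]] := @sum_prod_mod8 _ (fun i => x i ^+ k) (fun i => rpredX k (xZ i)).
  rewrite (power_sum_odd s_gt0 s_even split_A) // expr0n sub0r => def_e.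
  exists (- e); rewrite ?rpredN // mulrN -def_e opprK.
  by apply: eq_bigr => i _; rewrite -exprM mulnC.
have [||e2 e2Z def_e2] := even_sum (n - 2 * s)%N; try lia.
have [||e3 e3Z def_e3] := even_sum (n - 3 * s)%N; try lia.
pose z i := x i ^+ (2 * (n - 2 * s)) + x i ^+ (n - s + (n - 2 * s))
  + 3 * x i ^+ (n - 2 * s + (n - 3 * s)).
have [Z ZZ def_Z] : exists2 Z, Z \in Aint & \sum_i z i = Z.
  exists (\sum_i z i) => //; apply: rpred_sum => i _.
  by rewrite !rpredD // ?rpredM ?rpredX.
exists (5 * e3 + 3 * e2 + Z); first by rewrite !rpredD ?rpredM.
transitivity (\sum_i (x i ^+ (2 * (n - s)) + 9 * x i ^+ (2 * (n - 3 * s))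
    + 6 * x i ^+ (2 * (n - 2 * s)) + 4 * z i)).
  apply: eq_bigr => i _; rewrite /z.
  have -> : x i ^+ (2 * (n - s)) = x i ^+ (n - s) ^+ 2 by rewrite mulnC exprM.
  have -> : x i ^+ (2 * (n - 3 * s)) = x i ^+ (n - 3 * s) ^+ 2 by rewrite mulnC exprM.
  have -> : x i ^+ (2 * (n - 2 * s)) = x i ^+ (n - s) * x i ^+ (n - 3 * s).
    by rewrite -exprD; congr (_ ^+ _); lia.
  have sqr_b : x i ^+ (n - 2 * s) ^+ 2 = x i ^+ (n - s) * x i ^+ (n - 3 * s).
    by rewrite -exprM -exprD; congr (_ ^+ _); lia.
  rewrite !(exprD _ (_ - _) (_ - _)); move: sqr_b.
  set a := x i ^+ (n - s); set b := x i ^+ _; set c := x i ^+ _ => sqr_b.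
  transitivity (a ^+ 2 + 9 * c ^+ 2 + 6 * (a * c) + 4 * (b ^+ 2 + a * b + 3 * (b * c))).
    by ring.
  by rewrite sqr_b.
rewrite !big_split /= -!mulr_sumr (power_sum_double s_gt0 s_even n_odd n_gt3s split_A).
by rewrite def_Z def_e2 def_e3; ring.
Qed.

(** Congruences are taken in the ring of algebraic integers. Writing n = 2 m + 1 and
s = 2 u puts the product of the n + s h(x i) in the form to which [sum_prod_mod8]
applies, with summands m + u h(x i). *)
Theorem pentanomial_disc_mod8 (n s : nat) (x : 'I_n -> algC) :
    (0 < s)%N -> ~~ odd s -> odd n -> (3 * s < n)%N ->
    pentanomial algC n s = \prod_i ('X - (x i)%:P) ->
  exists2 w : algC, w \in Aint &
   (-1) ^+ 'C(n, 2) * \prod_(p : 'I_n * 'I_n | (p.1 < p.2)%N) (x p.1 - x p.2) ^+ 2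
     = n%:R + 8 * w.
Proof.
move=> s_gt0 s_even n_odd n_gt3s split_x; rewrite -prod_deriv_root /= -split_x.
have root_x i : root (pentanomial algC n s) (x i).
  rewrite split_x -big_enum -(big_map x predT (fun c => 'X - c%:P)).
  by rewrite root_prod_XsubC map_f // mem_enum.
have xZ i : x i \in Aint.
  apply: root_monic_Aint (root_x i) (pentanomial_monic _ s_gt0 n_gt3s) _.
  by apply/polyOverP => k; rewrite !coefD !coefXn coef1 !rpredD ?rpred_nat.
have split_A := reverse_pentanomial n_gt3s split_x.
pose h i := x i ^+ (n - s) + 2 * x i ^+ (n - 2 * s) + 3 * x i ^+ (n - 3 * s).
have prod_x : \prod_i x i = -1.
  have : \prod_i (0 - x i) = 1 :> algC.
    transitivity (\prod_i ('X - (x i)%:P)).[0].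
      by rewrite horner_prod; apply: eq_bigr => i _; rewrite hornerXsubC.
    rewrite -split_x !hornerE !expr0n.
    by do 4!(case: eqP => [?|_]; first lia); rewrite !add0r.
  rewrite (eq_bigr (fun i => -1 * x i)) => [|i _]; last by rewrite sub0r mulN1r.
  rewrite big_split /= prodr_const card_ord -signr_odd n_odd expr1 mulN1r.
  by move/eqP; rewrite eqr_oppLR => /eqP.
pose m := n./2; pose u := s./2.
have def_n : n%:R = 2 * m%:R + 1 :> algC.
  by rewrite -[n in LHS]odd_double_half n_odd natrD -mul2n natrM addrC.
have def_s : s%:R = 2 * u%:R :> algC by rewrite -natrM mul2n even_halfK.
have -> : \prod_i (pentanomial algC n s)^`().[x i] = \prod_i (1 + 2 * (m%:R + u%:R * h i)).
  apply: (@mulfI _ (-1)); first by rewrite oppr_eq0 oner_eq0.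
  rewrite -{1}prod_x -big_split /=.
  rewrite (eq_bigr (fun i => -1 * (1 + 2 * (m%:R + u%:R * h i)))).
    by rewrite big_split /= prodr_const card_ord -signr_odd n_odd expr1.
  move=> i _; rewrite (deriv_root_pentanomial n_gt3s (root_x i)) -/(h i) def_n def_s.
  by ring.
have natZ k : (k%:R : algC) \in Aint by exact: rpred_nat.
have hZ i : h i \in Aint by rewrite !rpredD // ?rpredM ?rpredX.
have sum_h : \sum_i h i = 0.
  rewrite /h !big_split /= -!mulr_sumr.
  rewrite !(power_sum_odd s_gt0 s_even split_A); try lia.
  by rewrite !mulr0 !addr0.
have [v vZ sum_h2] := pentanomial_sum_sqr s_gt0 s_even n_odd n_gt3s xZ split_A.
rewrite -/(\sum_i h i ^+ 2) in sum_h2.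
have yZ i : m%:R + u%:R * h i \in Aint by rewrite rpredD ?rpredM.
have [e [w [eZ wZ + ->]]] := sum_prod_mod8 yZ.
have -> : \sum_i (m%:R + u%:R * h i) = n%:R * m%:R.
  by rewrite big_split /= -mulr_sumr sum_h mulr0 addr0 sumr_const card_ord mulr_natl.
have -> : \sum_i (m%:R + u%:R * h i) ^+ 2 = n%:R * m%:R ^+ 2 + u%:R ^+ 2 * (4 * v).
  transitivity (\sum_i (m%:R ^+ 2 + (2 * m%:R * u%:R * h i + u%:R ^+ 2 * h i ^+ 2))).
    by apply: eq_bigr => i _; ring.
  rewrite !big_split /= -!mulr_sumr sum_h sum_h2 mulr0 add0r sumr_const card_ord.
  by rewrite -[_ *+ n]mulr_natl; ring.
(* With n = 2 m + 1, the product is n + 4 m ^ 2 (m + 1) modulo 8, and m (m + 1) is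
   even. *)
move=> def_e; pose q : algC := (m * m.+1)./2%:R.
have def_q : m%:R * (m%:R + 1) = 2 * q.
  by rewrite -natrM mul2n even_halfK ?oddM /= ?andbN // natrM -addn1 natrD.
exists (w - u%:R ^+ 2 * v + m%:R * q + m%:R ^+ 4).
  by rewrite !rpredD ?rpredN ?rpredM ?rpredX ?natZ.
rewrite def_n in def_e *.
transitivity (1 + 2 * ((2 * m%:R + 1) * m%:R) + 2 * (2 * e) + 8 * w); first by ring.
rewrite -def_e; transitivity (2 * m%:R + 1 + 8 * (w - u%:R ^+ 2 * v + m%:R ^+ 4)
  + 4 * m%:R * (m%:R * (m%:R + 1)) : algC); first by ring.
by rewrite def_q; ring.
Qed.

Unset Implicit Arguments.
Set Strict Implicit.

Theorem proposition3p1 (s n : nat) (s_gt0 : (0 < s)%N) (s_even : ~~ odd s)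
    (n_odd : odd n) (n_gt3s : (3 * s < n)%N) :
  let f : {poly 'F_2} :=
    'X^n + 'X^(n - s) + 'X^(n - 2 * s) + 'X^(n - 3 * s) + 1 in
  (num_irr_factors f
     = if (n == 1 %[mod 8])%N || (n == 7 %[mod 8])%N then 1 else 0
     %[mod 2])%N.
Proof.
move=> f; have sep_f := pentanomial_separable s_even n_odd n_gt3s.
have [r split_r] := closed_field_poly_normal (pentanomial algC n s).
rewrite (eqP (pentanomial_monic _ s_gt0 n_gt3s)) scale1r in split_r.
have size_r : size r = n.
  by apply/succn_inj; rewrite -(size_pentanomial algC s_gt0 n_gt3s) split_r size_prod_XsubC.
pose x (i : 'I_n) : algC := r`_i.
have split_x : pentanomial algC n s = \prod_i ('X - (x i)%:P).
  by rewrite split_r (big_nth 0) big_mkord size_r.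
have [|d [disc_d d_mod8]] := Stickelberger_Swan (map_pentanomial _ n s) sep_f (x := x).
  by rewrite map_pentanomial.
have [w wZ def_w] := pentanomial_disc_mod8 s_gt0 s_even n_odd n_gt3s split_x.
rewrite disc_d in def_w.
(* The algebraic integer [w] is rational, so the congruence holds in Z. *)
have [k disc_k] : exists k : int, (-1) ^+ 'C(n, 2) * d = n%:Z + 8 * k.
  have w_rat : w \in Crat.
    have -> : w = ((-1) ^+ 'C(n, 2) * d%:~R - n%:R) / 8 by rewrite def_w; field.
    by rewrite rpred_div ?rpredB ?rpredM ?rpredX ?rpredN ?rpred1 ?rpred_int ?rpred_nat.
  have /intrP[k def_k] := Cint_rat_Aint w_rat wZ.
  exists k; apply/(@intr_inj algC).
  by rewrite rmorphM rmorphXn rmorphN1 /= def_w rmorphD rmorphM /= def_k.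
have odd_bin : odd 'C(n, 2) = odd n./2.
  rewrite -[n in LHS]odd_double_half n_odd add1n bin2 /= -doubleMr doubleK oddM /=.
  by rewrite odd_double.
move: disc_k d_mod8; rewrite -signr_odd odd_bin -/(pentanomial _ n s) -/f.
(* The two values of [d] modulo 8: 1 + 4 (n + t), and [n] up to the sign given by
   the parity of n./2. *)
move: (num_irr_factors f) n_odd => t; clear.
by case: (boolP (odd n./2)) => m_odd n_odd; rewrite ?expr1 ?expr0 => dE d_mod8; case: ifP; lia.
Qed.
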